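(* Let $G$ be a graph of maximum degree $\Delta\geq 1$, and let $e$ be an edge of $G$. Then the neighborhood $N^{\mathsf s}_e$ of $e$ in $L^2(G)$ induces in $L^2(G)$ a graph with at most $$\frac{3}{2}\Delta^4+5\Delta^3$$ edges.
   Context: All graphs are finite and simple. $L^2(G)$ denotes the square of the line graph $L(G)$ of $G$, i.e. the graph with vertex set $E(G)$ in which two distinct edges of $G$ are adjacent if and only if they share an endvertex or some edge of $G$ joins an endvertex of one to an endvertex of the other. For an edge $e$ of $G$, $N^{\mathsf s}_e\subseteq E(G)$ denotes the neighborhood of $e$ in $L^2(G)$ (not containing $e$ itself). *)

(* Defs.v *)
From mathcomp Require Import all_boot.

Set Implicit Arguments.
Unset Strict Implicit.
Unset Printing Implicit Defensive.

Record sgraph := SGraph {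
  vertex :> finType;
  adj : rel vertex;
  adj_sym : symmetric adj;
  adj_irr : irreflexive adj
}.

(* Edges are the two-element sets of endvertices. *)
Definition edges (G : sgraph) : {set {set G}} :=
  [set [set p.1; p.2] | p in [pred p : G * G | adj p.1 p.2]].

(* Open neighborhood: [x] itself is excluded, since [adj] is irreflexive. *)
Definition neighborhood (G : sgraph) (x : G) : {set G} := [set y | adj x y].

Definition max_degree (G : sgraph) : nat := \max_(x : G) #|neighborhood x|.

Section Induced.
Variables (G : sgraph) (S : {set G}).

Definition induced_adj : rel {x : G | x \in S} :=
  fun u v => adj (val u) (val v).

Lemma induced_adj_sym : symmetric induced_adj.
Proof. by move=> u v; rewrite /induced_adj adj_sym. Qed.

Lemma induced_adj_irr : irreflexive induced_adj.
Proof. by move=> u; rewrite /induced_adj adj_irr. Qed.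

Definition induced : sgraph := SGraph induced_adj_sym induced_adj_irr.
End Induced.

Section Square.
Variable G : sgraph.

Definition square_adj : rel G := fun x y =>
  (x != y) && (adj x y || [exists z, adj x z && adj z y]).

Lemma square_adj_sym : symmetric square_adj.
Proof.
move=> x y; rewrite /square_adj eq_sym adj_sym.
by congr (_ && (_ || _)); apply: eq_existsb => z; rewrite andbC !(adj_sym z).
Qed.

Lemma square_adj_irr : irreflexive square_adj.
Proof. by move=> x; rewrite /square_adj eqxx. Qed.

Definition square : sgraph := SGraph square_adj_sym square_adj_irr.
End Square.

Section LineGraph.
Variable G : sgraph.

Definition line_adj : rel {f : {set G} | f \in edges G} := fun e f =>
  (e != f) && (val e :&: val f != set0).

Lemma line_adj_sym : symmetric line_adj.
Proof. by move=> e f; rewrite /line_adj eq_sym setIC. Qed.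

Lemma line_adj_irr : irreflexive line_adj.
Proof. by move=> e; rewrite /line_adj eqxx. Qed.

Definition line_graph : sgraph := SGraph line_adj_sym line_adj_irr.
End LineGraph.

(* Explicit description of adjacency in the square of the line graph. *)
Lemma adj_square_line (G : sgraph) (e f : square (line_graph G)) :
  adj e f = (e != f) && ((val e :&: val f != set0) ||
    [exists x in val e, exists y in val f, adj x y]).
Proof.
rewrite -[LHS]/((e != f) && (line_adj e f || [exists g, line_adj e g && line_adj g f])).
case: (eqVneq e f) => //= nef; rewrite {1}/line_adj nef /=.
case: (boolP (val e :&: val f == set0)) => //= dis.
have disP z : z \in val e -> z \in val f -> false.
  by move=> ze zf; move/eqP/setP/(_ z): dis; rewrite !inE ze zf.
apply/existsP/exists_inP => [[g] | [x xe /exists_inP[y yf xy]]].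
  case/andP=> /andP[_ /set0Pn[x /setIP[xe xg]]].
  case/andP=> _ /set0Pn[y /setIP[yg yf]].
  exists x => //; apply/exists_inP; exists y => //.
  case/imsetP: (svalP g) => -[a b]; rewrite inE /= => ab gE.
  rewrite [val g]gE in xg yg; case/set2P: xg xe => ->; case/set2P: yg yf => -> //.
  - by move=> af /disP/(_ af).
  - by move=> *; rewrite adj_sym.
  - by move=> bf /disP/(_ bf).
have gP : [set x; y] \in edges G by apply/imsetP; exists (x, y).
exists (exist _ [set x; y] gP); rewrite /line_adj; apply/andP; split.
  apply/andP; split; last by apply/set0Pn; exists x; rewrite !inE xe eqxx.
  apply/eqP=> eE; have: y \in val e by rewrite eE /= !inE eqxx orbT.
  by move/disP/(_ yf).
apply/andP; split; last by apply/set0Pn; exists y; rewrite !inE yf eqxx orbT.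
apply/eqP=> fE; have: x \in val f by rewrite -fE /= !inE eqxx.
by move/(disP _ xe).
Qed.

(* Main.v *)
(* Write e = uv and A = N(u) U N(v), so |A| <= 2 Delta and the edges in the strong
   neighborhood of e all meet A.  Adjacent ordered pairs (f, g) of such edges come
   from walks x' - x - w - w' with f = x'x and g = ww'.  If a, b lie in A and y, z
   outside A, a 4-cycle a y b z yields two walks for the pair (ay, bz), so one of
   them, y - a - z - b, can be discarded.
   Let S be the sum of d_A(y)^2 over y outside A, which is also the sum over a, b in
   A of the number c(a,b) of common neighbors outside A.  There are at most
   2 Delta^4 + Delta S walks and exactly sum c(a,b)^2 discarded ones, and
   4 Delta c <= 4 c^2 + Delta^2 gives Delta S <= sum c^2 + Delta^4.  Hence at most
   3 Delta^4 ordered pairs remain. *)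
Require Import Defs.
From mathcomp Require Import all_boot all_order all_algebra.
From mathcomp Require Import zify lra.
Import Order.TTheory GRing.Theory Num.Theory.

Set Implicit Arguments.
Unset Strict Implicit.
Unset Printing Implicit Defensive.

Lemma card_sigma_set (T U : finType) (P : pred T) (F : T -> {set U}) :
  #|[set q : T * U | P q.1 && (q.2 \in F q.1)]| = \sum_(t | P t) #|F t|.
Proof.
rewrite -sum1_card; under [RHS]eq_bigr do rewrite -sum1_card.
by rewrite pair_big_dep; apply: eq_bigl => q; rewrite inE.
Qed.

Lemma card_edges_double (H : sgraph) :
  2 * #|edges H| <= #|[set p : H * H | adj p.1 p.2]|.
Proof.
rewrite -[leqRHS]sum1_card.
rewrite (partition_big (fun p : H * H => [set p.1; p.2]) (mem (edges H))) /=; last first.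
  by move=> p; rewrite inE => pP; apply/imsetP; exists p.
rewrite mulnC -sum_nat_const; apply: leq_sum => f /imsetP[[x y]]; rewrite inE /= => xy ->.
have nxy : (x, y) != (y, x).
  by apply: contraTneq xy => -[-> _]; rewrite adj_irr.
have two : #|[set (x, y); (y, x)]| = 2 by rewrite cards2 nxy.
rewrite sum1_card -[leqLHS]two; apply/subset_leq_card.
apply/subsetP=> p /set2P[] ->; rewrite unfold_in /= inE /=; first by rewrite xy eqxx.
by rewrite adj_sym xy setUC eqxx.
Qed.

Lemma edge_endvertex (G : sgraph) (f : {set G}) (x : G) :
  f \in edges G -> x \in f -> exists2 y, adj x y & f = [set x; y].
Proof.
case/imsetP=> -[a b]; rewrite inE /= => ab -> /set2P[] ->; first by exists b.
by exists a; rewrite 1?adj_sym // setUC.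
Qed.

(** If [f] and [g] share [z], then [f] itself serves as the link: its other endvertex is adjacent to
    [z], which lies in [g]. *)
Lemma adj_square_line_link (G : sgraph) (f g : square (line_graph G)) :
  adj f g -> exists x w, [/\ x \in val f, w \in val g & adj x w].
Proof.
rewrite adj_square_line => /andP[_ /orP[/set0Pn[z /setIP[zf zg]]|]]; last first.
  by move=> /exists_inP[x xf /exists_inP[w wg xw]]; exists x, w.
have [y zy fE] := edge_endvertex (svalP f) zf.
by exists y, z; rewrite [val f]fE set22 adj_sym.
Qed.

Section Walks.
Variables (G : sgraph) (A : {set G}) (Delta : nat).
Hypothesis degD : forall x : G, #|neighborhood x| <= Delta.
Hypothesis cardA : #|A| <= 2 * Delta.

Local Notation N := (@neighborhood G).

Definition Aedge_end (x : G) : {set G} := [set x' in N x | (x \in A) || (x' \in A)].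

(* The tuple ((x, w), (x', w')) stands for the walk x' - x - w - w'. *)
Definition walks : {set (G * G) * (G * G)} :=
  [set q | adj q.1.1 q.1.2 && (q.2 \in setX (Aedge_end q.1.1) (Aedge_end q.1.2))].

Definition outer_common (a b : G) : {set G} := N a :&: N b :\: A.

(** The cycle a y b z is stored as [((a, b), (y, z))]. The degenerate cases a = b and y = z are
    included, so that the count is exactly the sum of c(a,b)^2. *)
Definition four_cycles : {set (G * G) * (G * G)} :=
  [set q | ((q.1.1 \in A) && (q.1.2 \in A)) &&
           (q.2 \in setX (outer_common q.1.1 q.1.2) (outer_common q.1.1 q.1.2))].

Definition cycle_walk (q : (G * G) * (G * G)) := ((q.1.1, q.2.2), (q.2.1, q.1.2)).

Definition redundant_walks : {set (G * G) * (G * G)} := cycle_walk @: four_cycles.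

Lemma redundant_walksE (x w x' w' : G) :
  ((x, w), (x', w')) \in redundant_walks =
  [&& x \in A, w' \in A, x' \notin A, w \notin A,
     adj x x', adj x w, adj w' x' & adj w' w].
Proof.
apply/imsetP/idP => [[[[a b] [y z]]] | ].
  rewrite !inE /= => /andP[/andP[aA bA]] /andP[/and3P[yA ay bY] /and3P[zA az bz]].
  by case=> -> -> -> ->; rewrite aA bA yA zA ay bY az bz.
case/and5P=> xA w'A x'A wA /and4P[xx' xw w'x' w'w].
exists ((x, w'), (x', w)) => //.
by rewrite !inE /= xA w'A x'A wA xx' xw w'x' w'w.
Qed.

Lemma redundant_sub_walks : redundant_walks \subset walks.
Proof.
apply/subsetP=> -[[x w] [x' w']]; rewrite redundant_walksE.
case/and5P=> xA w'A x'A wA /and4P[xx' xw w'x' w'w].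
by rewrite !inE /= xw xx' xA adj_sym w'w w'A orbT.
Qed.

Let outdeg2 := \sum_(w | w \notin A) #|N w :&: A| * #|N w :&: A|.

(** Both sides count the walks a - w - b with a, b in [A] and w outside [A]. *)
Lemma sum_outer_common :
  \sum_(p : G * G | (p.1 \in A) && (p.2 \in A)) #|outer_common p.1 p.2| = outdeg2.
Proof.
under eq_bigr do rewrite -sum1_card.
have -> : outdeg2 = \sum_(w | w \notin A) \sum_(p in setX (N w :&: A) (N w :&: A)) 1.
  by apply: eq_bigr => w _; rewrite sum1_card cardsX.
rewrite (exchange_big_dep (fun w => w \notin A)) /=; last first.
  by move=> p w _; rewrite !inE => /andP[].
apply: eq_bigr => w wA; apply: eq_bigl => -[a b].
rewrite !inE /= wA /= !(adj_sym w).
by case: (a \in A); case: (b \in A); rewrite ?andbF ?andbT.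
Qed.

Lemma leq_card_redundant : Delta * outdeg2 <= #|redundant_walks| + Delta ^ 4.
Proof.
have inj : injective cycle_walk by move=> [[? ?] [? ?]] [[? ?] [? ?]] [-> -> -> ->].
rewrite card_imset // /four_cycles.
rewrite (card_sigma_set (fun p : G * G => (p.1 \in A) && (p.2 \in A))
  (fun p => setX (outer_common p.1 p.2) (outer_common p.1 p.2))).
under eq_bigr do rewrite cardsX.
(* The factor 4 clears the denominator in Delta c <= c^2 + Delta^2 / 4. The error Delta^2 is summed
   over |A|^2 <= 4 Delta^2 pairs. *)
rewrite -(leq_pmul2l (isT : 0 < 4)) -sum_outer_common mulnDr mulnA !big_distrr /=.
apply: (@leq_trans (\sum_(p : G * G | (p.1 \in A) && (p.2 \in A))
   (4 * (#|outer_common p.1 p.2| * #|outer_common p.1 p.2|) + Delta ^ 2))).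
  by apply: leq_sum => p _; have [+ _] := nat_Cauchy (2 * #|outer_common p.1 p.2|) Delta; lia.
rewrite big_split /= leq_add2l sum_nat_const.
have -> : #|[pred p : G * G | (p.1 \in A) && (p.2 \in A)]| = #|A| * #|A|.
  by rewrite -cardsX; apply: eq_card => p; rewrite !inE.
have := leq_mul cardA cardA; nia.
Qed.

(** Walks are grouped by their middle edge xw. If both ends are in [A], there are at most Delta^2
    walks; if only x is, at most Delta d_A(w), which sums to Delta S. Those with x outside [A] are
    charged to the edges from x to [A]. Each x in [A] is then charged at most Delta^2 per incident
    edge, hence Delta^3. *)
Lemma leq_card_walks : #|walks| <= 2 * Delta ^ 4 + Delta * outdeg2.
Proof.
rewrite /walks (card_sigma_set (fun p : G * G => adj p.1 p.2)
  (fun p => setX (Aedge_end p.1) (Aedge_end p.2))).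
under eq_bigr do rewrite cardsX.
rewrite -(pair_big_dep predT (@adj G) (fun x w => #|Aedge_end x| * #|Aedge_end w|)) /=.
have endD x : #|Aedge_end x| <= Delta.
  by apply: leq_trans (degD x); apply/subset_leq_card/subsetP=> y; rewrite inE => /andP[].
have endN x : x \notin A -> #|Aedge_end x| = #|N x :&: A|.
  by move=> xA; apply: eq_card => y; rewrite !inE (negPf xA).
(* Double counting of the edges between [A] and its complement. *)
have swap (F : G -> nat) : \sum_(x in A) \sum_(w in N x :\: A) F w
    = \sum_(w | w \notin A) #|N w :&: A| * F w.
  rewrite (exchange_big_dep (fun w => w \notin A)) /=; last first.
    by move=> x w _; rewrite inE => /andP[].
  apply: eq_bigr => w wA; rewrite sum_nat_const; congr (_ * _).
  by apply: eq_card => x; rewrite [LHS]unfold_in /= !inE wA (adj_sym w) andbC.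
(* Here x has d_A(x) edges into [A], and each is charged Delta^2: Delta choices of w and Delta of
   w'. *)
have outer : \sum_(x | x \notin A) \sum_(w | adj x w) #|Aedge_end x| * #|Aedge_end w|
    <= \sum_(x in A) #|N x :\: A| * Delta ^ 2.
  under [leqRHS]eq_bigr do rewrite -sum_nat_const.
  rewrite swap; apply: leq_sum => x xA; rewrite -big_distrr /= endN // leq_mul2l.
  apply/orP; right; apply: (@leq_trans (\sum_(w in N x) Delta)).
    by rewrite (eq_bigl (mem (N x))) => [|w]; [exact: leq_sum | rewrite !inE].
  by rewrite sum_nat_const expnS expn1 leq_mul2r degD orbT.
have inner : \sum_(x in A) \sum_(w | adj x w) #|Aedge_end x| * #|Aedge_end w|
    <= \sum_(x in A) #|N x :&: A| * Delta ^ 2 + Delta * outdeg2.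
  have -> : outdeg2 = \sum_(x in A) \sum_(w in N x :\: A) #|N w :&: A| by rewrite swap.
  rewrite big_distrr -big_split /=.
  apply: leq_sum => x xA; rewrite (eq_bigl (mem (N x))) => [|w]; last by rewrite !inE.
  rewrite (big_setID A) /= -sum_nat_const big_distrr /=; apply: leq_add.
    by apply: leq_sum => w _; rewrite expnS expn1 leq_mul.
  by apply: leq_sum => w /setDP[_ wA]; rewrite -endN // leq_mul.
rewrite (bigID (mem A)) /=; apply: leq_trans (leq_add inner outer) _.
rewrite addnAC -big_split /= leq_add2r.
apply: (@leq_trans (\sum_(x in A) Delta ^ 3)).
  by apply: leq_sum => x _; rewrite -mulnDl cardsID expnS leq_mul2r degD orbT.
by rewrite sum_nat_const; have := cardA; nia.
Qed.

Lemma card_linked_pairs (R : {set {set G} * {set G}}) :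
  (forall f g, (f, g) \in R ->
     [/\ f \in edges G, g \in edges G, f :&: A != set0, g :&: A != set0
       & exists x w, [/\ x \in f, w \in g & adj x w]]) ->
  #|R| <= 3 * Delta ^ 4.
Proof.
move=> hR; pose ends (q : (G * G) * (G * G)) := ([set q.1.1; q.2.1], [set q.1.2; q.2.2]).
have sub : R \subset ends @: (walks :\: redundant_walks).
  apply/subsetP=> -[f g] /hR[fE gE fA gA [x [w [xf wg xw]]]].
  have [x' xx' fxx] := edge_endvertex fE xf; have [w' ww' gww] := edge_endvertex gE wg.
  have meet a b : [set a; b] :&: A != set0 -> (a \in A) || (b \in A).
    by case/set0Pn=> c /setIP[/set2P[] ->] ->; rewrite ?orbT.
  rewrite fxx gww in fA gA *.
  have qW : ((x, w), (x', w')) \in walks.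
    by rewrite !inE /= xw xx' ww' !meet.
  case qC: (((x, w), (x', w')) \in redundant_walks); last first.
    by apply/imsetP; exists ((x, w), (x', w')); rewrite // inE qC.
  (* The walk x - x' - w' - w joins the same two edges. *)
  move: (qC); rewrite redundant_walksE.
  case/and5P=> xA w'A x'A wA /and4P[_ _ w'x' _].
  apply/imsetP; exists ((x', w'), (x, w)); last by rewrite /ends /= (setUC [set x]) (setUC [set w]).
  (* A redundant walk has its second vertex in [A], whereas here that vertex is [x']. *)
  rewrite inE redundant_walksE (negPf x'A) /=.
  by rewrite !inE /= xA w'A orbT adj_sym w'x' adj_sym xx' adj_sym ww'.
apply: leq_trans (subset_leq_card sub) (leq_trans (leq_imset_card _ _) _).
(* The term Delta S cancels between the two bounds, leaving 2 Delta^4 + Delta^4. *)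
rewrite cardsDS ?redundant_sub_walks //.
rewrite leq_subLR (leq_trans leq_card_walks) // (mulSn 2) addnA addnC.
by rewrite leq_add2r leq_card_redundant.
Qed.

End Walks.

Local Open Scope ring_scope.

Theorem lemma4 (G : sgraph) (Delta : nat) (hDelta : max_degree G = Delta)
    (Delta_ge1 : (1 <= Delta)%N) (e : square (line_graph G)) :
  #|edges (induced (neighborhood e))|%:R
    <= 3%:R / 2%:R * Delta%:R ^+ 4 + 5%:R * Delta%:R ^+ 3 :> rat.
Proof.
have degD x : (#|@neighborhood G x| <= Delta)%N.
  by rewrite -hDelta; exact: (leq_bigmax (F := fun x => #|@neighborhood G x|)).
have [A cardA eA] : exists2 A : {set G}, (#|A| <= 2 * Delta)%N &
    forall x y, x \in val e -> adj x y -> y \in A.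
  case/imsetP: (svalP e) => -[u v] /= _ eE.
  exists (neighborhood u :|: neighborhood v).
    by rewrite (leq_trans (leq_card_setU _ _)) // mul2n -addnn leq_add.
  by move=> x y; rewrite [val e]eE => /set2P[] -> xy; rewrite !inE xy ?orbT.
set H := induced _.
(* The link from [e] enters [f] at a neighbor of an endvertex of [e]. *)
have meetA (f : H) : val (val f) :&: A != set0.
  have := svalP f; rewrite inE => /adj_square_line_link[x [w [xe wf xw]]].
  by apply/set0Pn; exists w; rewrite inE wf (eA x).
pose pr (p : H * H) : {set G} * {set G} := (val (val p.1), val (val p.2)).
have pr_inj : injective pr.
  by move=> [f g] [f' g'] [/val_inj/val_inj-> /val_inj/val_inj->].
have bound : (2 * #|edges H| <= 3 * Delta ^ 4)%N.
  apply: leq_trans (card_edges_double H) _.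
  rewrite -(card_imset _ pr_inj); apply: (card_linked_pairs degD cardA).
  move=> f1 g1 /imsetP[[f g]]; rewrite inE /= => fg [-> ->].
  split; [exact: svalP (val f) | exact: svalP (val g) | exact: meetA | exact: meetA |].
  exact: adj_square_line_link fg.
have : (2 * #|edges H|)%:R <= (3 * Delta ^ 4)%:R :> rat by rewrite ler_nat.
rewrite (natrM _ 2) (natrM _ 3) natrX.
have : 0 <= Delta%:R ^+ 3 :> rat by rewrite exprn_ge0 ?ler0n.
by lra.
Qed.
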